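(* Let $\alpha\in(0,1]$. Let $R>0$, $h(x)=R-\sum_{i=1}^n x_i^2$ and $B=\{x\in\mathbb{R}^n\mid h(x)\ge 0\}$, and assume $\Omega(X_0)\subseteq B$, where $\Omega(X_0)=\{f(x_0,d)\mid x_0\in X_0,\ d\in D\}\cup X_0$. Let $u\in\mathbb{R}[x]$ be a polynomial for which there exist sum-of-squares polynomials $s^{X_i}_{i,l_1},s^{D}_{i,l_2},s_{i,1}\in\Sigma[x,d]$ ($i=1,\dots,k$, $l_1=1,\dots,n_i$, $l_2=1,\dots,n_{k+1}$) and $s'_{1,j}\in\Sigma[x]$ ($j=1,\dots,n_0$) such that $$u(x)-\alpha u(f_i(x,d))+\sum_{l_1=1}^{n_i}s^{X_i}_{i,l_1}(x,d)\,h_{i,l_1}(x)+\sum_{l_2=1}^{n_{k+1}}s^{D}_{i,l_2}(x,d)\,h_{k+1,l_2}(d)-s_{i,1}(x,d)\,h(x)\in\Sigma[x,d]$$ for every $i=1,\dots,k$, and $$\big(1+h_{0,j}(x)^2\big)u(x)-h_{0,j}(x)-s'_{1,j}(x)\,h(x)\in\Sigma[x]$$ for every $j=1,\dots,n_0$ (e.g. $u$ is the polynomial component of an optimal solution of the semi-definite program minimizing $\int_B u\,dx$ subject to these constraints). Then $\{x\in B\mid u(x)\le 0\}\subseteq\mathcal{R}_0$, i.e. it is a robust invariant set. Furthermore, if $\alpha\in(0,1)$, then $u(x)\ge 0$ for all $x\in B$, and consequently $\{x\in B\mid u(x)\le 0\}=\{x\in B\mid u(x)=0\}$.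
   Context: Here $\mathbb{N}=\{0,1,2,\dots\}$ and $\Sigma[y]$ denotes the set of sum-of-squares polynomials in the variables $y$, i.e. polynomials of the form $\sum_i q_i^2$ with $q_i\in\mathbb{R}[y]$. Fix integers $n,m,k\ge 1$. Let $h_{0,1},\dots,h_{0,n_0}\in\mathbb{R}[x]$ ($x\in\mathbb{R}^n$) and let $X_0=\{x\in\mathbb{R}^n\mid h_{0,j}(x)\le 0,\ j=1,\dots,n_0\}$, assumed compact. Let $X_1,\dots,X_k\subseteq\mathbb{R}^n$ be pairwise disjoint sets with $\bigcup_{i=1}^k X_i=\mathbb{R}^n$, each of the form $X_i=\{x\mid h_{i,j}(x)\rhd 0,\ j=1,\dots,n_i\}$ with polynomials $h_{i,j}$ and $\rhd\in\{\le,<\}$. Let $D=\{d\in\mathbb{R}^m\mid h_{k+1,l}(d)\le 0,\ l=1,\dots,n_{k+1}\}$ with polynomials $h_{k+1,l}$. Let $f_1,\dots,f_k:\mathbb{R}^n\times\mathbb{R}^m\to\mathbb{R}^n$ be polynomial maps and define $f(x,d)=f_i(x,d)$ whenever $x\in X_i$. An input policy is a sequence $\pi=(d(l))_{l\in\mathbb{N}}$ with $d(l)\in D$; $\Pi$ is the set of all input policies. For $x\in\mathbb{R}^n$ and $\pi\in\Pi$, the trajectory is $\phi^\pi_x(0)=x$, $\phi^\pi_x(l+1)=f(\phi^\pi_x(l),d(l))$. The maximal robust invariant set is $\mathcal{R}_0=\{x\in\mathbb{R}^n\mid \phi^\pi_x(l)\in X_0\ \forall l\in\mathbb{N},\ \forall\pi\in\Pi\}$;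 a robust invariant set is any subset of $\mathcal{R}_0$.
   Formalization: In the ''Furthermore'' part (u ≥ 0 on B and the equality of the two sets, for α in (0,1)), the set D is additionally assumed to be nonempty, since that part can fail when D is empty. *)

(* Defs.v *)
From mathcomp Require Import all_boot all_order all_algebra.
From mathcomp Require Import boolp classical_sets functions reals.
From mathcomp Require Import topology normedtype.
(* The notations of mpoly clash with those of MathComp-Analysis; the few needed
   ones are declared below. *)
From mathcomp Require Import -(notations) mpoly.

Set Implicit Arguments.
Unset Strict Implicit.
Unset Printing Implicit Defensive.

Import Order.TTheory GRing.Theory Num.Theory.
Import numFieldNormedType.Exports.

Local Open Scope ring_scope.
Local Open Scope classical_set_scope.

Notation "{ 'mpoly' T [ n ] }" := (mpoly n T)
  (at level 0, T at level 2, n at level 2, format "{ 'mpoly'  T [ n ] }").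
Notation "p \mPo lq" := (comp_mpoly lq p) (at level 50).
Notation "''X_' i" := (mpolyX _ (mnm1 i))
  (at level 8, i at level 2, format "''X_' i").

Section Polynomials.
Context {R : realType}.

Definition peval {N : nat} (p : {mpoly R[N]}) (x : 'rV[R]_N) : R :=
  meval (fun j => x ord0 j) p.

Definition sos {N : nat} (p : {mpoly R[N]}) : Prop :=
  exists s : seq {mpoly R[N]}, p = \sum_(q <- s) q ^+ 2.

(* The n + m variables of R[x, d] are the n coordinates of x followed by the m
   coordinates of d, so that the point (x, d) is [row_mx x d]. *)
Definition pmap_eval {n m : nat} (F : n.-tuple {mpoly R[n + m]})
    (x : 'rV[R]_n) (d : 'rV[R]_m) : 'rV[R]_n :=
  \row_(j < n) peval (tnth F j) (row_mx x d).

Definition poly_of_x {n : nat} (m : nat) (p : {mpoly R[n]}) : {mpoly R[n + m]} :=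
  p \mPo [tuple 'X_(lshift m j) | j < n].

Definition poly_of_d (n : nat) {m : nat} (p : {mpoly R[m]}) : {mpoly R[n + m]} :=
  p \mPo [tuple 'X_(rshift n j) | j < m].

Definition le0_set {N c : nat} (h : 'I_c -> {mpoly R[N]}) : set 'rV[R]_N :=
  [set x | forall j, peval (h j) x <= 0].

(* The j-th constraint is [h j < 0] if [strict j] and [h j <= 0] otherwise. *)
Definition semialg_set {N c : nat} (strict : 'I_c -> bool)
    (h : 'I_c -> {mpoly R[N]}) : set 'rV[R]_N :=
  [set x | forall j,
     if strict j then peval (h j) x < 0 else peval (h j) x <= 0].

Definition ball_poly (n : nat) (r : R) : {mpoly R[n]} :=
  mpolyC n r - \sum_(j < n) 'X_j ^+ 2.

Definition ball_set (n : nat) (r : R) : set 'rV[R]_n :=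
  [set x | 0 <= peval (ball_poly n r) x].

End Polynomials.
Arguments ball_set {R} n r _.

Section Dynamics.
Context {R : realType} {n m : nat}.
Variable f : 'rV[R]_n -> 'rV[R]_m -> 'rV[R]_n.

Definition policies (D : set 'rV[R]_m) : set (nat -> 'rV[R]_m) :=
  [set p | forall l, D (p l)].

Fixpoint trajectory (p : nat -> 'rV[R]_m) (x : 'rV[R]_n) (l : nat) : 'rV[R]_n :=
  if l is l'.+1 then f (trajectory p x l') (p l') else x.

Definition max_robust_invariant (X0 : set 'rV[R]_n) (D : set 'rV[R]_m) :
    set 'rV[R]_n :=
  [set x | forall l p, policies D p -> X0 (trajectory p x l)].

Definition robust_invariant (X0 : set 'rV[R]_n) (D : set 'rV[R]_m)
    (S : set 'rV[R]_n) : Prop :=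
  S `<=` max_robust_invariant X0 D.

Definition one_step_reach (X0 : set 'rV[R]_n) (D : set 'rV[R]_m) :
    set 'rV[R]_n :=
  [set f x d | x in X0 & d in D] `|` X0.

End Dynamics.

(* Feasibility of the sum-of-squares program for [u]: [h0], [hX i] and [hD] are
   the polynomials describing X_0, X_i and D, and [F i] is the map f_i. *)
Definition sos_certificate {R : realType} {n m k n0 nD : nat} {nX : 'I_k -> nat}
    (h0 : 'I_n0 -> {mpoly R[n]})
    (hX : forall i : 'I_k, 'I_(nX i) -> {mpoly R[n]})
    (hD : 'I_nD -> {mpoly R[m]})
    (F : 'I_k -> n.-tuple {mpoly R[n + m]})
    (alpha r : R) (u : {mpoly R[n]}) : Prop :=
  exists (sX : forall i : 'I_k, 'I_(nX i) -> {mpoly R[n + m]})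
         (sD : 'I_k -> 'I_nD -> {mpoly R[n + m]})
         (s1 : 'I_k -> {mpoly R[n + m]})
         (s1' : 'I_n0 -> {mpoly R[n]}),
    [/\ [/\ forall i l, sos (sX i l),
            forall i l, sos (sD i l),
            forall i, sos (s1 i)
          & forall j, sos (s1' j)],
        forall i : 'I_k,
          sos (poly_of_x m u - mpolyC (n + m) alpha * (u \mPo F i)
               + \sum_(l < nX i) sX i l * poly_of_x m (hX i l)
               + \sum_(l < nD) sD i l * poly_of_d n (hD l)
               - s1 i * poly_of_x m (ball_poly n r))
      & forall j : 'I_n0,
          sos ((1 + h0 j ^+ 2) * u - h0 j - s1' j * ball_poly n r)].

(* Main.v *)
(* On B x D the first certificate gives alpha u(f(x,d)) <= u(x), and on B the
   second gives h_{0,j} <= (1 + h_{0,j}^2) u. Hence a point of B with u <= 0 lies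
   in X_0, and its successor lies in Omega(X_0), so in B, again with u <= 0. The
   second inequality also gives u >= h / (1 + h^2) >= -1/2 on B, while
   alpha^l u(phi(l)) <= u(x) along trajectories: for alpha < 1 this rules out
   u(x) < 0. *)
Require Import Defs.
From mathcomp Require Import all_boot all_order all_algebra.
From mathcomp Require Import boolp classical_sets functions reals.
From mathcomp Require Import topology normedtype sequences.
From mathcomp Require Import -(notations) mpoly.
From mathcomp Require Import lra.

Set Implicit Arguments.
Unset Strict Implicit.
Unset Printing Implicit Defensive.

Import Order.TTheory GRing.Theory Num.Theory.
Import numFieldNormedType.Exports.

Local Open Scope ring_scope.
Local Open Scope classical_set_scope.

Lemma exists_exp_lt {R : realType} (a e : R) : 0 < a -> a < 1 -> 0 < e ->
  exists l : nat, a ^+ l < e.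
Proof.
move=> a_gt0 a_lt1 e_gt0.
have a_norm : `|a| < 1 by rewrite gtr0_norm.
have /cvgrPdist_lt /(_ e e_gt0) [l _ /(_ l (leqnn l))] := cvg_expr a_norm.
by rewrite /= sub0r normrN ger0_norm ?exprn_ge0 ?ltW //; exists l.
Qed.

Section Evaluation.
Context {R : realType}.

Lemma pevalD {N : nat} (p q : {mpoly R[N]}) (x : 'rV[R]_N) :
  peval (p + q) x = peval p x + peval q x.
Proof. exact: mevalD. Qed.

Lemma pevalB {N : nat} (p q : {mpoly R[N]}) (x : 'rV[R]_N) :
  peval (p - q) x = peval p x - peval q x.
Proof. exact: mevalB. Qed.

Lemma pevalM {N : nat} (p q : {mpoly R[N]}) (x : 'rV[R]_N) :
  peval (p * q) x = peval p x * peval q x.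
Proof. exact: mevalM. Qed.

Lemma pevalC {N : nat} (c : R) (x : 'rV[R]_N) : peval (mpolyC N c) x = c.
Proof. exact: mevalC. Qed.

Lemma pevalXn {N : nat} (p : {mpoly R[N]}) (e : nat) (x : 'rV[R]_N) :
  peval (p ^+ e) x = peval p x ^+ e.
Proof. exact: (rmorphXn (meval _)). Qed.

Lemma peval_sum {N : nat} (I : Type) (s : seq I) (q : I -> {mpoly R[N]})
    (x : 'rV[R]_N) :
  peval (\sum_(i <- s) q i) x = \sum_(i <- s) peval (q i) x.
Proof. exact: (raddf_sum (meval _)). Qed.

Lemma sos_ge0 {N : nat} (p : {mpoly R[N]}) (x : 'rV[R]_N) :
  sos p -> 0 <= peval p x.
Proof.
case=> s ->; rewrite peval_sum.
by apply: sumr_ge0 => q _; rewrite pevalXn sqr_ge0.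
Qed.

Lemma peval_comp {N M : nat} (p : {mpoly R[N]}) (lq : N.-tuple {mpoly R[M]})
    (z : 'rV[R]_M) :
  peval (p \mPo lq) z = peval p (\row_j peval (tnth lq j) z).
Proof.
by rewrite /peval comp_mpoly_meval; apply: meval_eq => j; rewrite mxE.
Qed.

Lemma peval_poly_of_x {n m : nat} (p : {mpoly R[n]}) (x : 'rV[R]_n)
    (d : 'rV[R]_m) : peval (poly_of_x m p) (row_mx x d) = peval p x.
Proof.
rewrite peval_comp; congr peval; apply/rowP => j.
by rewrite mxE tnth_mktuple /peval mevalXU row_mxEl.
Qed.

Lemma peval_poly_of_d {n m : nat} (p : {mpoly R[m]}) (x : 'rV[R]_n)
    (d : 'rV[R]_m) : peval (poly_of_d n p) (row_mx x d) = peval p d.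
Proof.
rewrite peval_comp; congr peval; apply/rowP => j.
by rewrite mxE tnth_mktuple /peval mevalXU row_mxEr.
Qed.

Lemma peval_ball_poly {n : nat} (r : R) (x : 'rV[R]_n) :
  peval (ball_poly n r) x = r - \sum_(j < n) x ord0 j ^+ 2.
Proof.
rewrite pevalB pevalC peval_sum; congr (_ - _).
by apply: eq_bigr => j _; rewrite pevalXn /peval mevalXU.
Qed.

(** Serves to exclude an empty list of constraints [h0]: then [le0_set h0] would be the whole space,
    which does not fit in the ball. *)
Lemma ball_set_neqT (n : nat) (r : R) : (0 < n)%N -> 0 < r ->
  ball_set n r <> setT.
Proof.
move=> n_gt0 r_gt0 ballT.
(* Since [(1 + r) ^+ 2 > r], the first coordinate of this point already puts it outside the ball. *)
have : ball_set n r (const_mx (1 + r)) by rewrite ballT.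
rewrite /ball_set /= peval_ball_poly leNgt => /negP; apply.
rewrite (bigD1 (Ordinal n_gt0)) //= mxE opprD addrA.
have sum_ge0 : 0 <= \sum_(j < n | j != Ordinal n_gt0)
    (const_mx (1 + r) : 'rV[R]_n) ord0 j ^+ 2.
  by apply: sumr_ge0 => j _; rewrite sqr_ge0.
nra.
Qed.

(** The multipliers only exploit the sign [h <= 0], so strict and non-strict constraints can be
    treated alike from here on. *)
Lemma semialg_set_le0 {N c : nat} (strict : 'I_c -> bool)
    (h : 'I_c -> {mpoly R[N]}) : semialg_set strict h `<=` le0_set h.
Proof. by move=> x hx j; have := hx j; case: (strict j) => // /ltW. Qed.

End Evaluation.

Section Certificate.
Context {R : realType} {n m k n0 nD : nat} {nX : 'I_k -> nat}.
Variables (h0 : 'I_n0 -> {mpoly R[n]})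
  (hX : forall i : 'I_k, 'I_(nX i) -> {mpoly R[n]})
  (hD : 'I_nD -> {mpoly R[m]}) (F : 'I_k -> n.-tuple {mpoly R[n + m]})
  (alpha r : R) (u : {mpoly R[n]}).
Hypothesis u_cert : sos_certificate h0 hX hD F alpha r u.

(** Evaluate the first certificate at the point (x, d): the total is nonnegative, whereas every
    multiplier term contributes a nonpositive amount, by the signs of the constraints on X_i, D and
    B. *)
Lemma certificate_step (i : 'I_k) (x : 'rV[R]_n) (d : 'rV[R]_m) :
  ball_set n r x -> le0_set (@hX i) x -> le0_set hD d ->
  alpha * peval u (pmap_eval (F i) x d) <= peval u x.
Proof.
case: u_cert => sX [sD [s1 [_ [[sosX sosD sos1 _] step _]]]] Bx Xx Dd.
have := sos_ge0 (row_mx x d) (step i).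
rewrite pevalB 2!pevalD pevalB !pevalM pevalC !peval_poly_of_x peval_comp.
rewrite !peval_sum.
have sumX_le0 : \sum_(l < nX i)
    peval (sX i l * poly_of_x m (hX l)) (row_mx x d) <= 0.
  apply: sumr_le0 => l _; rewrite pevalM peval_poly_of_x.
  by rewrite mulr_ge0_le0 ?sos_ge0 //; apply: Xx.
have sumD_le0 : \sum_(l < nD)
    peval (sD i l * poly_of_d n (hD l)) (row_mx x d) <= 0.
  apply: sumr_le0 => l _; rewrite pevalM peval_poly_of_d.
  by rewrite mulr_ge0_le0 ?sos_ge0 //; apply: Dd.
have s1B_ge0 : 0 <= peval (s1 i) (row_mx x d) * peval (ball_poly n r) x.
  by apply: mulr_ge0 => //; apply: sos_ge0.
rewrite /pmap_eval; lra.
Qed.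

Lemma certificate_h0 (j : 'I_n0) (x : 'rV[R]_n) : ball_set n r x ->
  peval (h0 j) x <= (1 + peval (h0 j) x ^+ 2) * peval u x.
Proof.
case: u_cert => _ [_ [_ [s1' [[_ _ _ sos1'] _ bound]]]] Bx.
have := sos_ge0 x (bound j).
rewrite !pevalB !pevalM pevalD pevalXn pevalC.
have : 0 <= peval (s1' j) x * peval (ball_poly n r) x.
  by apply: mulr_ge0 => //; apply: sos_ge0.
lra.
Qed.

Lemma certificate_sublevel (x : 'rV[R]_n) :
  ball_set n r x -> peval u x <= 0 -> le0_set h0 x.
Proof.
move=> Bx ux j; apply: le_trans (certificate_h0 j Bx) _.
by rewrite mulr_ge0_le0 // addr_ge0 // sqr_ge0.
Qed.

Lemma certificate_lower_bound (j : 'I_n0) (x : 'rV[R]_n) :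
  ball_set n r x -> - 1 <= 2 * peval u x.
Proof.
move=> /(certificate_h0 j) bound.
have den_gt0 : 0 < 1 + peval (h0 j) x ^+ 2 by rewrite ltr_pwDl ?sqr_ge0.
rewrite -(ler_pM2l den_gt0).
(* With t the value of [h0 j], expanding (t + 1)^2 >= 0 gives -(1 + t^2) <= 2 t, and [bound] gives t
   <= (1 + t^2) u(x). *)
have := sqr_ge0 (peval (h0 j) x + 1).
lra.
Qed.

End Certificate.

Theorem theorem4 (R : realType) (n m k n0 nD : nat) (nX : 'I_k -> nat)
    (n_gt0 : (0 < n)%N) (m_gt0 : (0 < m)%N) (k_gt0 : (0 < k)%N)
    (h0 : 'I_n0 -> {mpoly R[n]})
    (X0_compact : compact (le0_set h0))
    (hX : forall i : 'I_k, 'I_(nX i) -> {mpoly R[n]})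
    (strict : forall i : 'I_k, 'I_(nX i) -> bool)
    (X_disjoint : trivIset setT (fun i => semialg_set (strict i) (hX i)))
    (X_cover : \bigcup_(i in setT) semialg_set (strict i) (hX i) = setT)
    (hD : 'I_nD -> {mpoly R[m]})
    (F : 'I_k -> n.-tuple {mpoly R[n + m]})
    (f : 'rV[R]_n -> 'rV[R]_m -> 'rV[R]_n)
    (fE : forall i x d, semialg_set (strict i) (hX i) x ->
            f x d = pmap_eval (F i) x d)
    (alpha : R) (alpha_gt0 : 0 < alpha) (alpha_le1 : alpha <= 1)
    (r : R) (r_gt0 : 0 < r)
    (Omega_sub : one_step_reach f (le0_set h0) (le0_set hD) `<=` ball_set n r)
    (u : {mpoly R[n]})
    (u_cert : sos_certificate h0 hX hD F alpha r u) :
  robust_invariant f (le0_set h0) (le0_set hD)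
    [set x | ball_set n r x /\ peval u x <= 0] /\
  (alpha < 1 -> le0_set hD !=set0 ->
     (forall x, ball_set n r x -> 0 <= peval u x) /\
     [set x | ball_set n r x /\ peval u x <= 0] =
     [set x | ball_set n r x /\ peval u x = 0]).
Proof.
have X0_B x : le0_set h0 x -> ball_set n r x.
  by move=> X0x; apply: Omega_sub; right.
have u_step x d : ball_set n r x -> le0_set hD d ->
    alpha * peval u (f x d) <= peval u x.
  move=> Bx Dd.
  have [i _ Xx] : (\bigcup_(i in setT) semialg_set (strict i) (hX i)) x.
    by rewrite X_cover.
  rewrite (fE i _ _ Xx); apply: (certificate_step u_cert) => //.
  exact: semialg_set_le0 Xx.
have sublevel_traj p x : policies (le0_set hD) p -> ball_set n r x ->
    peval u x <= 0 -> forall l,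
    ball_set n r (trajectory f p x l) /\ peval u (trajectory f p x l) <= 0.
  (* The two properties must be carried together: [u_step] holds only on the ball, and the next
     state is known to be in the ball only because u <= 0 puts the current one in X_0. *)
  move=> Dp Bx ux; elim=> [//|l [Bl ul]] /=; split.
    apply: Omega_sub; left; exists (trajectory f p x l); last by exists (p l).
    exact: (certificate_sublevel u_cert).
  by rewrite -(pmulr_rle0 _ alpha_gt0) (le_trans (u_step _ _ Bl (Dp l))).
split.
  move=> x [Bx ux] l p Dp; have [Bl ul] := sublevel_traj p x Dp Bx ux l.
  exact: (certificate_sublevel u_cert).
move=> alpha_lt1 [d Dd].
(* The lower bound on u comes from some constraint of X_0, so an index is needed. *)
have n0_gt0 : (0 < n0)%N.
  rewrite lt0n; apply/eqP => n0_eq0; apply: (ball_set_neqT n_gt0 r_gt0).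
  apply/seteqP; split=> // x _; apply: X0_B => j.
  by have := ltn_ord j; rewrite [X in (_ < X)%N]n0_eq0.
have u_ge0 x : ball_set n r x -> 0 <= peval u x.
  move=> Bx; rewrite leNgt; apply/negP => ux.
  (* A point of D yields a constant policy. Under the contradictory assumption u(x) < 0, its
     trajectory never leaves the ball, so both the decay estimate and the lower bound apply at every
     time. *)
  pose phi := trajectory f (fun=> d) x.
  have phi_B l : ball_set n r (phi l).
    by have [] := sublevel_traj (fun=> d) x (fun=> Dd) Bx (ltW ux) l.
  have decay l : alpha ^+ l * peval u (phi l) <= peval u x.
    elim: l => [|l IHl]; first by rewrite mul1r.
    rewrite exprSr -mulrA; apply: le_trans IHl.
    by rewrite ler_pM2l ?exprn_gt0 // u_step.
  (* The threshold is chosen because [decay] and u >= -1/2 at [phi l] force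
     [- alpha ^+ l <= 2 * peval u x] for all [l], which fails once [alpha ^+ l] drops below it. *)
  have [||l] := @exists_exp_lt _ alpha (- (2 * peval u x)) alpha_gt0; [lra..|].
  have := decay l.
  have := certificate_lower_bound u_cert (Ordinal n0_gt0) (phi_B l).
  have : 0 < alpha ^+ l by rewrite exprn_gt0.
  nra.
split=> //; apply/seteqP; split=> x [Bx ux]; split=> //; last by rewrite ux.
by apply/le_anti; rewrite ux u_ge0.
Qed.
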